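(* For every integer $k\ge 1$, $\chi(M_k^3,2)=2k$.
   Context: Hypergraphs $H=(V,E)$ are finite: $V$ is a nonempty finite set of vertices and $E$ is a set of subsets of $V$ (edges), each of size at least $2$; $H$ is $r$-uniform if all edges have size $r$. The edge set of a hypergraph being colored is allowed to be empty. A $k$-coloring $c:V\to\{1,\dots,k\}$ is proper if no edge is monochromatic; the chromatic number $\chi(H)$ is the least $m\ge 1$ such that $H$ has a proper $m$-coloring, and then $H$ is called $m$-chromatic. $M_k^r$ denotes the $r$-uniform matching with $k$ edges: $k$ pairwise disjoint edges of size $r$, every vertex belonging to some edge. A $t$-edge-coloring of $H=(V,E)$ is a partition $E=E_1\cup\dots\cup E_t$ into $t$ pairwise disjoint (possibly empty) color classes. A monochromatic copy of $T$ is a (not necessarily induced) subhypergraph isomorphic to $T$ all of whose edges lie in one class $E_i$. For an acyclic $r$-uniform hypergraph $T$ (such as $M_k^r$), the ($t$-color) chromatic Ramsey number $\chi(T,t)$ is the smallest positive integer $m$ such that under any $t$-edge-coloring of any $m$-chromatic $r$-uniform hypergraph there is a monochromatic copy of $T$. *)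

(* Defs.v *)
From mathcomp Require Import all_boot.

Set Implicit Arguments.
Unset Strict Implicit.
Unset Printing Implicit Defensive.

Record hypergraph := Hypergraph {
  vertex :> finType;
  edges : {set {set vertex}};
  vertex_gt0 : 0 < #|vertex|;
  edge_gt1 : forall e, e \in edges -> 1 < #|e| }.

Definition uniform (r : nat) (H : hypergraph) : Prop :=
  forall e, e \in edges H -> #|e| = r.

Definition proper_coloring (H : hypergraph) (k : nat) (c : {ffun H -> 'I_k}) :
    bool :=
  [forall e in edges H, ~~ [exists a, [forall x in e, c x == a]]].

Definition colorable (H : hypergraph) (k : nat) : bool :=
  [exists c : {ffun H -> 'I_k}, proper_coloring c].

Lemma colorable_ex (H : hypergraph) : exists m, (0 < m) && colorable H m.
Proof.
exists #|H|; rewrite vertex_gt0; apply/existsP.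
exists [ffun x => enum_rank x]; apply/forall_inP => e eE.
apply/existsPn => a; apply/negP => /forall_inP ca.
have /card_gt1P[x [y [xe ye /negP]]] := edge_gt1 eE; apply.
by apply/eqP/enum_rank_inj; have := ca x xe; have := ca y ye;
   rewrite !ffunE => /eqP -> /eqP ->.
Qed.

Definition chromatic_number (H : hypergraph) : nat := ex_minn (colorable_ex H).

(* The classes [D i] may be empty. *)
Definition edge_coloring (H : hypergraph) (t : nat)
    (D : 'I_t -> {set {set H}}) : Prop :=
  \bigcup_(i < t) D i = edges H /\
  forall i j, i != j -> [disjoint D i & D j].

(* [(W, F)] is a set of vertices and a set of edges of an ambient hypergraph
   on [V] which form a hypergraph isomorphic to [T]. *)
Definition is_copy (T : hypergraph) (V : finType) (W : {set V})
    (F : {set {set V}}) : Prop :=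
  exists f : T -> V,
    [/\ injective f, f @: [set: T] = W & [set f @: (e : {set T}) | e in edges T] = F].

Definition monochromatic_copy (T H : hypergraph) (t : nat)
    (D : 'I_t -> {set {set H}}) : Prop :=
  exists (i : 'I_t) (W : {set H}) (F : {set {set H}}),
    F \subset D i /\ is_copy T W F.

Definition chromatic_ramsey_prop (r : nat) (T : hypergraph) (t m : nat) : Prop :=
  forall H : hypergraph, uniform r H -> chromatic_number H = m ->
  forall D : 'I_t -> {set {set H}}, edge_coloring D -> monochromatic_copy T D.

(* The minimum need not exist for a [T] with cycles, so the chromatic Ramsey
   number is given as a relation: the [t]-color chromatic Ramsey number of the
   [r]-uniform hypergraph [T] exists and equals [m]. *)
Definition is_chromatic_ramsey (r : nat) (T : hypergraph) (t m : nat) : Prop :=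
  [/\ 0 < m, chromatic_ramsey_prop r T t m
    & forall m', 0 < m' -> chromatic_ramsey_prop r T t m' -> m <= m'].

(* The vertices of the matching are the pairs [(i, j)]; its [i]-th edge consists
   of the [r] pairs whose first component is [i]. *)
Definition matching_edge (r k : nat) (i : 'I_k) : {set 'I_k * 'I_r} :=
  [set x | x.1 == i].

Definition matching_edges (r k : nat) : {set {set 'I_k * 'I_r}} :=
  [set matching_edge r i | i : 'I_k].

Lemma card_matching_edge (r k : nat) (i : 'I_k) : #|matching_edge r i| = r.
Proof.
have -> : matching_edge r i = [set (i, j) | j : 'I_r].
  apply/setP => -[a b]; rewrite inE /=; apply/eqP/imsetP => [->|[j _ [-> _]] //].
  by exists b.
by rewrite card_imset ?card_ord // => x y [].
Qed.

Lemma matching_vertex_gt0 (r k : nat) :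
  1 < r -> 0 < k -> 0 < #|{: 'I_k * 'I_r}|.
Proof. by move=> /ltnW r0 k0; rewrite card_prod !card_ord muln_gt0 k0. Qed.

Lemma matching_edge_gt1 (r k : nat) :
  1 < r -> forall e, e \in matching_edges r k -> 1 < #|e|.
Proof. by move=> r1 e /imsetP[i _ ->]; rewrite card_matching_edge. Qed.

Definition matching (r k : nat) (hr : 1 < r) (hk : 0 < k) : hypergraph :=
  Hypergraph (matching_vertex_gt0 hr hk) (@matching_edge_gt1 r k hr).

(* Main.v *)
Require Import Defs.
From mathcomp Require Import all_boot.
From mathcomp Require Import zify.

Set Implicit Arguments.
Unset Strict Implicit.
Unset Printing Implicit Defensive.

(** Upper bound.  Split the edges of a 3-uniform hypergraph into two classes [A]
    and [B], neither with [n.+1] pairwise disjoint edges; then [n.*2.+1] colors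
    suffice ([colorable_of_small_matchings]).  The induction on [n] spends two
    new colors on a vertex set that contains an edge of each nonempty class and
    is the union of two independent sets; discarding all the edges that meet
    this set lowers both matching numbers ([no_matching_off]).

    Such a set is [e :|: f], where [e] in [A] and [f] in [B] are chosen with
    [#|e :&: f|] as large as possible ([two_independent_sets]).  If they share
    at least two vertices, then [e :|: f] has at most four vertices and splits
    into two sets too small to contain an edge.  If they share at most one,
    exchange a vertex of [e] outside [f] with a vertex of [f] outside [e]: each
    of the two resulting triples meets both [e] and [f] in more than
    [#|e :&: f|] vertices.  It is thus not an edge, of either class, by the
    choice of [e] and [f] ([exchange_not_edge]).  If one class is empty, any edge
    of the other one will do in place of [e :|: f].  So a hypergraph with no
    monochromatic [k]-matching is [(2 * k).-1]-colorable.

    Lower bound.  For [m < 2 * k] the complete 3-uniform hypergraph on [2 * m]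
    vertices is [m]-chromatic, since its independent sets are those of size at
    most 2.  Let the first class consist of the triples of vertices below
    [3 * k - 1], and the second one of the triples that use one of the at most
    [k - 1] other vertices.  A [k]-matching would cover [3 * k] vertices in the
    first class, and use [k] distinct ones of the other vertices in the
    second. *)

Section Hypergraph.
Variable V : finType.
Implicit Types (A B E M : {set {set V}}) (e f g P Q W : {set V}).

(** * Coloring from small matchings *)

Definition independent E P := forall e, e \in E -> ~~ (e \subset P).

Definition has_matching E n :=
  exists M, [/\ M \subset E, trivIset M & #|M| = n].

Lemma independent_card E P :
  (forall e, e \in E -> #|e| = 3) -> #|P| < 3 -> independent E P.
Proof.
move=> E3 P2 e eE; apply/negP => /subset_leq_card.
by rewrite E3 // leqNgt P2.
Qed.

Lemma has_matching1 E e : e \in E -> has_matching E 1.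
Proof.
move=> eE; exists [set e]; split; rewrite ?sub1set ?cards1 //.
by apply/trivIsetP => f g /set1P-> /set1P->; rewrite eqxx.
Qed.

Lemma no_matching_off E W e n :
  e \in E -> e != set0 -> e \subset W -> ~ has_matching E n.+1 ->
  ~ has_matching [set g in E | [disjoint g & W]] n.
Proof.
move=> eE /set0Pn[x xe] eW noE [M [ME Mtriv Mn]]; apply: noE.
have disjW g : g \in M -> [disjoint g & W].
  by move=> /(subsetP ME); rewrite inE => /andP[].
exists (e |: M); split.
- rewrite subUset sub1set eE /=.
  by apply: subset_trans ME _; apply/subsetP => g; rewrite inE => /andP[].
- have disj_e g : g \in M -> [disjoint e & g].
    by move=> /disjW; rewrite disjoint_sym; apply: disjointWl.
  move/trivIsetP: Mtriv => Mtriv; apply/trivIsetP => f g.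
  move=> /setU1P[->|fM] /setU1P[->|gM]; rewrite ?eqxx // => neq_fg.
  + exact: disj_e.
  + by rewrite disjoint_sym disj_e.
  + exact: Mtriv.
- rewrite cardsU1 Mn; case: (boolP (e \in M)) => // /disjW /pred0P/(_ x) /=.
  by rewrite xe (subsetP eW).
Qed.

(** The triple obtained from [f] by the exchange meets [f] in two vertices and
    [e] in [#|e :&: f|.+1] vertices, so putting it in [A] or in [B] contradicts
    the maximality of [#|e :&: f|]. *)
Lemma exchange_not_edge A B e f a c :
    (forall g, g \in A :|: B -> #|g| = 3) ->
    e \in A -> f \in B ->
    (forall e' f', e' \in A -> f' \in B -> #|e' :&: f'| <= #|e :&: f|) ->
    #|e :&: f| <= 1 -> a \in e :\: f -> c \in f :\: e ->
  independent (A :|: B) (a |: f :\ c).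
Proof.
move=> E3 eA fB emax ef1 /setDP[ae af] /setDP[cf ce] g gE; apply/negP => gP.
have f2 : #|f :\ c| = 2.
  by have := cardsD1 c f; rewrite cf E3 ?inE ?fB ?orbT // => -[].
have afc : a \notin f :\ c by rewrite !inE (negPf af) andbF.
have /eqP gE' : g == a |: f :\ c by rewrite eqEcard gP cardsU1 afc f2 E3.
case/setUP: gE => [gA|gB].
  have := leq_trans (emax _ _ gA fB) ef1; apply/negP; rewrite -ltnNge -f2.
  by apply: subset_leq_card; rewrite subsetI subD1set gE' subsetUr.
have := emax _ _ eA gB; apply/negP; rewrite -ltnNge.
have <- : #|a |: e :&: f| = #|e :&: f|.+1.
  by rewrite cardsU1 inE (negPf af) andbF.
apply: subset_leq_card; apply/subsetP => x /setU1P[->|/setIP[xe xf]].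
  by rewrite gE' !inE eqxx ae.
rewrite gE' !inE xe xf /= andbT orbC.
by case: eqP xe => // ->; rewrite (negPf ce).
Qed.

(** A shared vertex together with [f :\: e], and the rest of [e], have at most
    two vertices each.  The case [f := e] serves when one class is empty. *)
Lemma split_close_edges E e f :
    (forall g, g \in E -> #|g| = 3) -> #|e| = 3 -> #|f| = 3 ->
    1 < #|e :&: f| ->
  exists P Q, [/\ independent E P, independent E Q & e :|: f = P :|: Q].
Proof.
move=> E3 e3 f3 ef2.
have /set0Pn[x xe] : e != set0 by rewrite -card_gt0 e3.
exists (x |: f :\: e), (e :\ x); split.
- apply: independent_card => //; rewrite cardsU1.
  by move: (cardsID e f); rewrite setIC f3; case: (_ \notin _); lia.
- by apply: independent_card => //; move: (cardsD1 x e); rewrite xe e3; lia.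
- apply/setP => y; rewrite !inE.
  by case: eqP => [->|_] /=; rewrite ?xe //; case: (y \in e); case: (y \in f).
Qed.

Lemma max_intersection A B e0 f0 : e0 \in A -> f0 \in B ->
  exists e f, [/\ e \in A, f \in B &
    forall e' f', e' \in A -> f' \in B -> #|e' :&: f'| <= #|e :&: f|].
Proof.
move=> e0A f0B; have p0 : (e0, f0) \in setX A B by rewrite !inE e0A.
case: (arg_maxnP (fun p : {set V} * {set V} => #|p.1 :&: p.2|) p0).
move=> [e f] /= /setXP[eA fB] emax; exists e, f; split=> // e' f' e'A f'B.
by apply: (emax (e', f')); apply/setXP.
Qed.

Lemma two_independent_sets A B e0 :
    (forall g, g \in A :|: B -> #|g| = 3) -> e0 \in A :|: B ->
  exists P Q,
    [/\ independent (A :|: B) P, independent (A :|: B) Q,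
        A != set0 -> exists2 e, e \in A & e \subset P :|: Q &
        B != set0 -> exists2 f, f \in B & f \subset P :|: Q].
Proof.
move=> E3 e0E.
have [A0|/set0Pn[a0 a0A]] := eqVneq A set0; last first.
  have [B0|/set0Pn[b0 b0B]] := eqVneq B set0; last first.
    have [e [f [eA fB emax]]] := max_intersection a0A b0B.
    have e3 : #|e| = 3 by rewrite E3 // inE eA.
    have f3 : #|f| = 3 by rewrite E3 // inE fB orbT.
    suff [P [Q [indP indQ efPQ]]] : exists P Q,
        [/\ independent (A :|: B) P, independent (A :|: B) Q
          & e :|: f = P :|: Q].
      by exists P, Q; split=> // _; [exists e | exists f];
         rewrite // -efPQ ?subsetUl ?subsetUr.
    have [ef2|ef1] := ltnP 1 #|e :&: f|; first exact: split_close_edges.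
    have /card_gt0P[a aef] : 0 < #|e :\: f|.
      by move: (cardsID f e); rewrite e3; lia.
    have /card_gt0P[c cfe] : 0 < #|f :\: e|.
      by move: (cardsID e f); rewrite setIC f3; lia.
    exists (a |: f :\ c), (c |: e :\ a); split.
    - exact: (exchange_not_edge E3 eA fB emax ef1 aef cfe).
    - rewrite (setUC A); apply: (exchange_not_edge _ fB eA) cfe aef => //.
      + by move=> g; rewrite setUC; apply: E3.
      + by move=> f' e' f'B e'A; rewrite setIC (setIC f); apply: emax.
      + by rewrite setIC.
    - case/setDP: aef => ae _; case/setDP: cfe => cf _.
      apply/setP => x; rewrite !inE.
      case: (eqVneq x a) => [->|_] /=; first by rewrite ae.
      case: (eqVneq x c) => [->|_] /=; first by rewrite cf orbT.
      exact: orbC.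
  have a03 : #|a0| = 3 by rewrite E3 // inE a0A.
  have [|P [Q [indP indQ a0PQ]]] := split_close_edges E3 a03 a03.
    by rewrite setIid a03.
  exists P, Q; split=> // _.
  by exists a0; rewrite // -a0PQ subsetUl.
have e03 := E3 _ e0E.
have [|P [Q [indP indQ e0PQ]]] := split_close_edges E3 e03 e03.
  by rewrite setIid e03.
exists P, Q; split=> // _.
by exists e0; [move: e0E; rewrite A0 set0U | rewrite -e0PQ subsetUl].
Qed.

Lemma colorable_of_small_matchings n A B :
    (forall g, g \in A :|: B -> #|g| = 3) ->
    ~ has_matching A n.+1 -> ~ has_matching B n.+1 ->
  exists2 c : V -> nat, forall x, c x < n.*2.+1 &
    forall a, independent (A :|: B) [set x | c x == a].
Proof.
elim: n A B => [|n IHn] A B E3 noA noB.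
  exists (fun _ => 0) => // a e /setUP[] /has_matching1; last by move/noB.
  by move/noA.
have [E0|/set0Pn[e0 e0E]] := eqVneq (A :|: B) set0.
  by exists (fun _ => 0) => // a e; rewrite E0 inE.
have [P [Q [indP indQ PA PB]]] := two_independent_sets E3 e0E.
set W := P :|: Q in PA PB.
pose off E := [set g in E | [disjoint g & W]].
have offU : off A :|: off B \subset A :|: B.
  by apply: setUSS; apply/subsetP => g; rewrite inE => /andP[].
have no_off E : (forall g, g \in E -> #|g| = 3) ->
    (E != set0 -> exists2 e, e \in E & e \subset W) ->
    ~ has_matching E n.+2 -> ~ has_matching (off E) n.+1.
  move=> E3' PE noE; have [E0|/PE[e eE eW]] := eqVneq E set0.
    move=> [M [ME _ Mn]]; have := subset_leq_card ME; rewrite Mn E0.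
    suff -> : off set0 = set0 by rewrite cards0.
    by apply/setP => g; rewrite !inE.
  by apply: (no_matching_off eE) noE; rewrite -?card_gt0 ?E3'.
have E3A g : g \in A -> #|g| = 3 by move=> gA; rewrite E3 // inE gA.
have E3B g : g \in B -> #|g| = 3 by move=> gB; rewrite E3 // inE gB orbT.
have [|c cn cind] := IHn (off A) (off B) _ (no_off _ E3A PA noA)
                                          (no_off _ E3B PB noB).
  by move=> g /(subsetP offU); apply: E3.
pose c' x := if x \in P then n.*2.+1 else if x \in Q then n.*2.+2 else c x.
exists c' => [x|a e eE].
  rewrite /c' doubleS; case: ifP => // _; case: ifP => // _.
  by have := cn x; lia.
apply/negP => /subsetP ca.
have c'a x : x \in e -> c' x = a by move=> /ca; rewrite inE => /eqP.
(* [c] stays below [n.*2.+1], so the size of [a] tells which of the three parts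
   of the vertex set contains the monochromatic edge [e]. *)
have [a_small|a_big] := ltnP a n.*2.+1.
  have eW x : x \in e -> (x \notin W) /\ c x = a.
    move=> /c'a; rewrite /c' inE negb_or.
    by case: ifP => _; [lia | case: ifP => _; [lia | split]].
  have /(cind a)/negP : e \in off A :|: off B.
    have eoff : [disjoint e & W].
      by rewrite disjoint_subset; apply/subsetP => x /eW[].
    by move: eE; rewrite !inE eoff !andbT.
  by apply; apply/subsetP => x /eW[_ cxa]; rewrite inE cxa.
have [aP|aQ] := eqVneq a n.*2.+1.
  apply: (negP (indP _ eE)); apply/subsetP => x /c'a; rewrite /c'.
  by case: ifP => // _; case: ifP => _; [lia | have := cn x; lia].
apply: (negP (indQ _ eE)); apply/subsetP => x /c'a; rewrite /c'.
by case: ifP => _; [lia | case: ifP => // _; have := cn x; lia].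
Qed.

(** * Copies of matchings *)

Lemma is_copy_matching r k (hr : 1 < r) (hk : 0 < k) M :
    trivIset M -> #|M| = k -> (forall e, e \in M -> #|e| = r) ->
  exists W, is_copy (matching hr hk) W M.
Proof.
move=> Mtriv Mk Mr.
have /card_gt0P[e0 e0M] : 0 < #|M| by rewrite Mk.
have /card_gt0P[x0 _] : 0 < #|e0| by rewrite Mr // ltnW.
pose m (i : 'I_k) := nth e0 (enum M) i.
have mM i : m i \in M by rewrite -mem_enum mem_nth // -cardE Mk.
pose h (p : 'I_k * 'I_r) := nth x0 (enum (m p.1)) p.2.
have hm p : h p \in m p.1 by rewrite -mem_enum mem_nth // -cardE Mr.
have hinj : injective h.
  move=> [i j] [i' j'] eq_h.
  have eq_m : m i = m i'.
    apply/eqP; apply: contraT => neq_m.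
    have /pred0P/(_ (h (i, j))) := trivIsetP Mtriv _ _ (mM i) (mM i') neq_m.
    by rewrite /= (hm (i, j)) {1}eq_h (hm (i', j')).
  have eq_i : i = i'.
    apply/val_inj/(uniqP e0 (enum_uniq M)) => //; rewrite inE -cardE Mk.
      exact: ltn_ord.
    exact: ltn_ord.
  rewrite -eq_i in eq_h *; congr (_, _).
  apply/val_inj/(uniqP x0 (enum_uniq (m i))) => //; rewrite inE -cardE Mr //.
    exact: ltn_ord.
  exact: ltn_ord.
have him i : h @: matching_edge r i = m i.
  apply/eqP; rewrite eqEcard card_imset // card_matching_edge Mr // leqnn andbT.
  by apply/subsetP => x /imsetP[p]; rewrite inE => /eqP <- ->.
exists (h @: setT), h; split=> //; apply/setP => e; apply/imsetP/idP.
  by move=> [_ /imsetP[i _ ->] ->]; rewrite him.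
move=> eM; have lt_e : index e (enum M) < k.
  by rewrite -Mk cardE index_mem mem_enum.
exists (matching_edge r (Ordinal lt_e)); first exact: imset_f.
by rewrite him /m /= nth_index // mem_enum.
Qed.

End Hypergraph.

Lemma chromatic_number_min (H : hypergraph) m :
  0 < m -> colorable H m -> chromatic_number H <= m.
Proof.
move=> m0 Hm; rewrite /chromatic_number.
by case: ex_minnP => n _; apply; rewrite m0.
Qed.

Lemma chromatic_ramsey_upper k (hk : 0 < k) :
  chromatic_ramsey_prop 3 (@matching 3 k isT hk) 2 (2 * k).
Proof.
case: k hk => // n hk H H3 chiH D [DE _].
have Ei i e : e \in D i -> e \in edges H.
  by move=> eD; rewrite -DE; apply/bigcupP; exists i.
have D01 : D ord0 :|: D ord_max = edges H.
  by rewrite -DE big_ord_recl big_ord1; congr (_ :|: D _); apply: val_inj.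
pose big_class := [exists i, [exists M : {set {set H}},
  [&& M \subset D i, trivIset M & #|M| == n.+1]]].
have [/existsP[i /existsP[M /and3P[MD Mtriv /eqP Mn]]]|none] := boolP big_class.
  have [|W copyW] := is_copy_matching (r := 3) isT hk Mtriv Mn.
    by move=> e /(subsetP MD)/Ei/H3.
  by exists i, W, M.
have small i : ~ has_matching (D i) n.+1.
  move=> [M [MD Mtriv Mn]]; case/negP: none.
  by apply/existsP; exists i; apply/existsP; exists M; rewrite MD Mtriv Mn eqxx.
have [|c cn cind] :=
    colorable_of_small_matchings _ (small ord0) (small ord_max).
  by move=> e; rewrite D01; apply: H3.
have : colorable H n.*2.+1.
  apply/existsP; exists [ffun x => Ordinal (cn x)].
  apply/forall_inP => e eE; apply/existsPn => a; apply/negP => /forall_inP ca.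
  have := cind a e; rewrite D01 => /(_ eE)/negP; apply.
  by apply/subsetP => x /ca; rewrite ffunE inE => /eqP <-.
by move/(chromatic_number_min (ltn0Sn _)); rewrite chiH; lia.
Qed.

(** * Complete triple systems *)

Section CompleteTriples.
Variables (m : nat) (m_gt0 : 0 < m).

Definition triples : {set {set 'I_(m.*2)}} :=
  [set e : {set 'I_(m.*2)} | #|e| == 3].

Lemma triples_vertex_gt0 : 0 < #|'I_(m.*2)|.
Proof. by rewrite card_ord double_gt0. Qed.

Lemma triples_edge_gt1 (e : {set 'I_(m.*2)}) : e \in triples -> 1 < #|e|.
Proof. by rewrite inE => /eqP->. Qed.

Definition complete_triples : hypergraph :=
  Hypergraph triples_vertex_gt0 triples_edge_gt1.

Lemma complete_triples_uniform : uniform 3 complete_triples.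
Proof. by move=> e; rewrite inE => /eqP. Qed.

Lemma colorable_complete_triples n : colorable complete_triples n = (m <= n).
Proof.
apply/existsP/idP => [[c /forall_inP cP]|le_mn].
  have fiber2 a : #|[set x | c x == a]| <= 2.
    rewrite leqNgt; apply/negP => fiber3.
    have [e ec e3] : exists2 e : {set 'I_(m.*2)},
        e \subset [set x | c x == a] & #|e| = 3.
      exists [set x in take 3 (enum [set x | c x == a])].
        by apply/subsetP => x; rewrite inE => /mem_take; rewrite mem_enum.
      rewrite cardsE (card_uniqP _) ?take_uniq ?enum_uniq //.
      by rewrite size_takel // -cardE.
    have /existsPn/(_ a)/negP : ~~ [exists a, [forall x in e, c x == a]].
      by apply: cP; rewrite inE e3.
    by apply; apply/forall_inP => x /(subsetP ec); rewrite inE.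
  rewrite -leq_double -[leqLHS]card_ord -sum1_card (partition_big c xpredT) //=.
  have -> : n.*2 = \sum_(a < n) 2 by rewrite sum_nat_const card_ord muln2.
  apply: leq_sum => a _.
  by rewrite sum1dep_card.
(* The color classes are the pairs [{2 a, 2 a + 1}]; parity is injective on
   each, so none contains a triple. *)
have half_lt (x : 'I_(m.*2)) : x./2 < n by have := ltn_ord x; lia.
exists [ffun x => Ordinal (half_lt x)].
apply/forall_inP => e; rewrite inE => /eqP e3.
apply/existsPn => a; apply/negP => /forall_inP ca.
have odd_inj : {in e &, injective (fun x : 'I_(m.*2) => odd x)}.
  move=> x y /ca xa /ca ya eq_odd; apply: val_inj.
  move: xa ya; rewrite !ffunE -!val_eqE /= => /eqP xa /eqP ya.
  by rewrite -(odd_double_half x) -(odd_double_half y) eq_odd xa ya.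
have := max_card (mem ((fun x : 'I_(m.*2) => odd x) @: e)).
by rewrite (card_in_imset odd_inj) e3 card_bool.
Qed.

Lemma chromatic_number_complete_triples : chromatic_number complete_triples = m.
Proof.
rewrite /chromatic_number; case: ex_minnP => n /andP[_].
rewrite colorable_complete_triples => le_mn /(_ m).
rewrite m_gt0 colorable_complete_triples leqnn => /(_ isT) le_nm.
by apply/eqP; rewrite eqn_leq le_nm le_mn.
Qed.

Lemma complete_triples_avoid k (hk : 0 < k) : m < 2 * k ->
  ~ chromatic_ramsey_prop 3 (@matching 3 k isT hk) 2 m.
Proof.
move=> lt_mk /(_ _ complete_triples_uniform chromatic_number_complete_triples).
pose low (x : 'I_(m.*2)) := x < 3 * k - 1.
pose D (i : 'I_2) := [set e in triples | [forall x in e, low x] == (i == ord0)].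
move=> /(_ D)[|i [W [F [FD [h [hinj _ hF]]]]]].
- split=> [|i j neq_ij].
    apply/setP => e; apply/bigcupP/idP => [[i _]|eE].
      by rewrite inE => /andP[].
    exists (if [forall x in e, low x] then ord0 else ord_max) => //.
    by rewrite inE eE /=; case: [forall x in e, low x].
  rewrite -setI_eq0; apply/eqP/setP => e; rewrite !inE.
  apply/negP => /andP[/andP[_ /eqP ei] /andP[_ /eqP ej]].
  move: neq_ij ei ej; case: [forall x in e, low x];
  by case: i => [[|[|?]] ?]; case: j => [[|[|?]] ?].
have hD a : h @: matching_edge 3 a \in D i.
  by apply: (subsetP FD); rewrite -hF; apply: imset_f; apply: imset_f.
have [i0|i1] := eqVneq i ord0.
  have h_low p : h p < 3 * k - 1.
    have := hD p.1; rewrite inE i0 => /andP[_ /eqP/forall_inP]; apply.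
    by apply: imset_f; rewrite inE.
  have : injective (fun p => Ordinal (h_low p)).
    by move=> p q [] /val_inj/hinj.
  by move=> /leq_card; rewrite card_prod !card_ord; lia.
have h_high a : exists j, 3 * k - 1 <= h (a, j).
  have := hD a; rewrite inE (negPf i1) => /andP[_].
  rewrite eqbF_neg negb_forall_in => /exists_inP[x /imsetP[[b j]]].
  by rewrite inE => /eqP /= -> ->; rewrite -leqNgt; exists j.
pose s a := h (a, xchoose (h_high a)).
have s_high a : 3 * k - 1 <= s a := xchooseP (h_high a).
have s_lt a : s a - (3 * k - 1) < k.-1.
  by have := ltn_ord (s a); have := s_high a; lia.
have : injective (fun a => Ordinal (s_lt a)).
  move=> a b [] eq_ab; have /hinj[] // : s a = s b.
  by apply: val_inj; have := s_high a; have := s_high b; move: eq_ab => /=; lia.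
by move=> /leq_card; rewrite !card_ord; lia.
Qed.

End CompleteTriples.

(** * The chromatic Ramsey number *)

Theorem corollary6 (k : nat) (hk : 0 < k) :
  is_chromatic_ramsey 3 (@matching 3 k isT hk) 2 (2 * k).
Proof.
split; first by rewrite muln_gt0.
  exact: chromatic_ramsey_upper.
move=> m m_gt0 ramsey_m; rewrite leqNgt; apply/negP => lt_mk.
exact: complete_triples_avoid lt_mk ramsey_m.
Qed.
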